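(* Let $P$ be a set of $n$ points in the plane with $\mathrm{diam}(P)$ bounded by a constant, and let $P'\subseteq P$. Then there is an algorithm running in $O(n)$ time on the real-RAM that computes a $P'$-dominating set $D^*\subseteq P$ with $|D^*|\le 4\,|\mathit{OPT}|$, where $\mathit{OPT}$ is a minimum-cardinality $P'$-dominating subset of $P$ (i.e., it $4$-approximates the minimum partial dominating set problem).
   Context: A point $p$ dominates a point $q$ if $\|pq\|\le 2$ (Euclidean distance). Given sets of points $D$ and $P'$, $D$ is a $P'$-dominating set if every point of $P'$ is dominated by some point of $D$. The minimum partial dominating set problem (PDS): given a finite point set $P$ and $P'\subseteq P$, find a smallest $P'$-dominating subset $D\subseteq P$. $\mathrm{diam}(P)$ is the maximum distance between two points of $P$. *)

(* Defs.v *)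
From HB Require Import structures.
From mathcomp Require Import all_boot all_order all_algebra.
From mathcomp Require Import finmap reals.

Set Implicit Arguments.
Unset Strict Implicit.
Unset Printing Implicit Defensive.

Import Order.TTheory GRing.Theory Num.Theory.

Local Open Scope fset_scope.
Local Open Scope ring_scope.

Section Domination.
Context {R : realType}.
Implicit Types (p q : R * R) (A D P : {fset R * R}).

Definition dist p q : R := Num.sqrt ((p.1 - q.1) ^+ 2 + (p.2 - q.2) ^+ 2).

(* Distances are nonnegative, so the neutral element 0 only matters when P is
   empty. *)
Definition diam P : R :=
  \big[Num.max/0]_(p <- P) \big[Num.max/0]_(q <- P) dist p q.

Definition dominates p q : Prop := dist p q <= 2.

Definition dominating_set A D : Prop :=
  forall q, q \in A -> exists2 p, p \in D & dominates p q.

Definition feasible_PDS P A D : Prop := D `<=` P /\ dominating_set A D.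

Definition optimal_PDS P A D : Prop :=
  feasible_PDS P A D /\
  forall D', feasible_PDS P A D' -> (#|` D| <= #|` D'|)%N.

End Domination.

(* A real-RAM with natural-number and real registers, and two unbounded
   memories (natural numbers and reals) accessed by indirect addressing.  There
   is no conversion between the two sorts: no rounding, and no square root.
   Constants are natural numbers, so a program carries no real data.  Truncated
   subtraction and x / 0 = 0 make every instruction total. *)
Inductive instr : Type :=
| IConst of nat & nat
| IAdd of nat & nat & nat
| ISub of nat & nat & nat
| ILoad of nat & nat
| IStore of nat & nat
| RConst of nat & nat
| RAdd of nat & nat & nat
| RSub of nat & nat & nat
| RMul of nat & nat & nat
| RDiv of nat & nat & nat
| RLoad of nat & nat
| RStore of nat & nat
| Jump of nat
| JumpILe of nat & nat & nat
| JumpRLe of nat & nat & nat.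

Definition program : Type := seq instr.

Section RealRAM.
Context {R : realType}.

Record config : Type := Config {
  pc : nat;
  ireg : nat -> nat;
  xreg : nat -> R;
  imem : nat -> nat;
  xmem : nat -> R
}.

Definition upd (T : Type) (m : nat -> T) (i : nat) (x : T) : nat -> T :=
  fun j => if j == i then x else m j.

Definition set_ireg (c : config) (d v : nat) : config :=
  Config (pc c).+1 (upd (ireg c) d v) (xreg c) (imem c) (xmem c).

Definition set_xreg (c : config) (d : nat) (v : R) : config :=
  Config (pc c).+1 (ireg c) (upd (xreg c) d v) (imem c) (xmem c).

Definition set_imem (c : config) (i v : nat) : config :=
  Config (pc c).+1 (ireg c) (xreg c) (upd (imem c) i v) (xmem c).

Definition set_xmem (c : config) (i : nat) (v : R) : config :=
  Config (pc c).+1 (ireg c) (xreg c) (imem c) (upd (xmem c) i v).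

Definition goto (c : config) (l : nat) : config :=
  Config l (ireg c) (xreg c) (imem c) (xmem c).

Definition exec_instr (i : instr) (c : config) : config :=
  let I := ireg c in let X := xreg c in
  match i with
  | IConst d k => set_ireg c d k
  | IAdd d a b => set_ireg c d (I a + I b)%N
  | ISub d a b => set_ireg c d (I a - I b)%N
  | ILoad d a => set_ireg c d (imem c (I a))
  | IStore a b => set_imem c (I a) (I b)
  | RConst d k => set_xreg c d k%:R
  | RAdd d a b => set_xreg c d (X a + X b)
  | RSub d a b => set_xreg c d (X a - X b)
  | RMul d a b => set_xreg c d (X a * X b)
  | RDiv d a b => set_xreg c d (X a / X b)
  | RLoad d a => set_xreg c d (xmem c (I a))
  | RStore a b => set_xmem c (I a) (X b)
  | Jump l => goto c l
  | JumpILe a b l => goto c (if (I a <= I b)%N then l else (pc c).+1)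
  | JumpRLe a b l => goto c (if X a <= X b then l else (pc c).+1)
  end.

(* The machine halts when the program counter leaves the program. *)
Definition step (prog : program) (c : config) : option config :=
  omap (fun i => exec_instr i c) (onth prog (pc c)).

Fixpoint steps (prog : program) (t : nat) (c : config) : option config :=
  if t is t'.+1 then obind (steps prog t') (step prog c) else Some c.

(* Unit-cost running time: exactly [t] instructions are executed. *)
Definition halts_in (prog : program) (c : config) (t : nat) (c' : config)
    : Prop :=
  steps prog t c = Some c' /\ step prog c' = None.

(* Point sets enter and leave the machine as duplicate-free lists of points, in
   any order. *)
Definition enumerates (s : seq (R * R)) (A : {fset R * R}) : Prop :=
  uniq s /\ s =i A.

(* The two list lengths are in natural-number registers 0 and 1; the
   coordinates x_0, y_0, x_1, y_1, ... of the first list, then those of the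
   second, start at real memory cell 0.  Everything else is 0. *)
Definition init_config (s s' : seq (R * R)) : config :=
  Config 0
    (fun i => nth 0%N [:: size s; size s'] i)
    (fun _ => 0)
    (fun _ => 0%N)
    (fun i => nth 0 (flatten [seq [:: p.1; p.2] | p <- s ++ s']) i).

(* The output length is in natural-number register 0, the coordinates start at
   real memory cell 0. *)
Definition output (c : config) : seq (R * R) :=
  [seq (xmem c i.*2, xmem c i.*2.+1) | i <- iota 0 (ireg c 0)].

End RealRAM.

Arguments config : clear implicits.

(* Main.v *)
Require Import Defs.
From HB Require Import structures.
From mathcomp Require Import all_boot all_order all_algebra.
From mathcomp Require Import finmap reals.
From mathcomp Require Import zify ring lra.

Set Implicit Arguments.
Unset Strict Implicit.
Unset Printing Implicit Defensive.

Import Order.TTheory GRing.Theory Num.Theory.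

Local Open Scope fset_scope.
Local Open Scope ring_scope.

(* Cover the plane around the input by a fixed number of cells of diameter less
   than 1/20 and keep, for each cell, a leftmost, rightmost, lowest and highest
   point of P.  This coreset has constant size, so a smallest subset of it that
   dominates P' is found in linear time by trying all subsets in order of size.

   Any p in P can be replaced by four coreset points.  Among the four extreme
   points of its cell there are two, e and f, with <e - p, f - p> <= 0.  A point
   q dominated by p but neither by e nor by f is almost at distance 2 from p, in a
   direction nearly orthogonal or obtuse to both e - p and f - p.  Either these
   directions fill an arc of little more than 90 degrees, or e - p and f - p are
   almost opposite and the directions form two short arcs.  In both cases the
   points q form two clusters of diameter at most 1.9, and any coreset point in
   the cell of one point of a cluster dominates the whole cluster. *)

(** * Structured programs *)

(** Structured control flow lets effects and running times be proved by composition, without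
    tracking program counters. *)
Inductive cmd : Type :=
| Skip
| Prim of instr
| Seq of cmd & cmd
| IfR of nat & nat & cmd & cmd
| While of nat & nat & cmd.

Fixpoint len (c : cmd) : nat :=
  match c with
  | Skip => 0
  | Prim _ => 1
  | Seq c1 c2 => len c1 + len c2
  | IfR _ _ c1 c2 => (len c2 + len c1).+2
  | While _ _ c1 => (len c1).+2
  end.

(** Jump targets are absolute, so the address [a] of the first instruction is a parameter. In a
    conditional the else branch is laid out first, because the machine jumps when the test
    succeeds. *)
Fixpoint compile (a : nat) (c : cmd) : program :=
  match c with
  | Skip => [::]
  | Prim i => [:: i]
  | Seq c1 c2 => compile a c1 ++ compile (a + len c1) c2
  | IfR x y c1 c2 =>
      JumpRLe x y (a.+1 + len c2).+1 :: compile a.+1 c2 ++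
      Jump ((a.+1 + len c2).+1 + len c1) :: compile (a.+1 + len c2).+1 c1
  | While x y c1 =>
      JumpILe x y (a.+1 + len c1).+1 :: compile a.+1 c1 ++ [:: Jump a]
  end.

Definition straight (i : instr) : bool :=
  match i with
  | Jump _ | JumpILe _ _ _ | JumpRLe _ _ _ => false
  | _ => true
  end.

Lemma size_compile a c : size (compile a c) = len c.
Proof.
elim: c a => //= [c1 IH1 c2 IH2|x y c1 IH1 c2 IH2|x y c1 IH1] a.
- by rewrite size_cat IH1 IH2.
- by rewrite size_cat /= IH1 IH2 addnS.
- by rewrite size_cat /= IH1 addn1.
Qed.

Fixpoint code_at (prog : program) (a : nat) (l : seq instr) : Prop :=
  if l is i :: l' then onth prog a = Some i /\ code_at prog a.+1 l' else True.

Lemma code_at_cat prog a l1 l2 :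
  code_at prog a (l1 ++ l2) ->
  code_at prog a l1 /\ code_at prog (a + size l1) l2.
Proof.
elim: l1 a => [|i l1 IH] a /=; first by rewrite addn0.
by case=> -> /IH[]; rewrite addnS.
Qed.

Lemma code_at_self prog : code_at prog 0 prog.
Proof.
suff H p1 l : code_at (p1 ++ l) (size p1) l by exact: (H [::] prog).
elim: l p1 => //= i l IH p1; split; first by rewrite onth_cat ltnn subnn.
by have := IH (rcons p1 i); rewrite cat_rcons size_rcons.
Qed.

Section Semantics.
Context {R : realType}.
Implicit Types (s : config R) (c : cmd).

(* [runs c s t s'] ignores the program counters of [s] and [s']. *)
Inductive runs : cmd -> config R -> nat -> config R -> Prop :=
| RunSkip s : runs Skip s 0 s
| RunPrim i s : straight i -> runs (Prim i) s 1 (exec_instr i s)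
| RunSeq c1 c2 s1 s2 s3 t1 t2 :
    runs c1 s1 t1 s2 -> runs c2 s2 t2 s3 -> runs (Seq c1 c2) s1 (t1 + t2) s3
| RunIfThen x y c1 c2 s1 s2 t :
    xreg s1 x <= xreg s1 y -> runs c1 s1 t s2 ->
    runs (IfR x y c1 c2) s1 t.+1 s2
| RunIfElse x y c1 c2 s1 s2 t :
    ~~ (xreg s1 x <= xreg s1 y) -> runs c2 s1 t s2 ->
    runs (IfR x y c1 c2) s1 t.+2 s2
| RunWhileEnd x y c s :
    (ireg s x <= ireg s y)%N -> runs (While x y c) s 1 s
| RunWhileStep x y c s1 s2 s3 t1 t2 :
    (ireg s1 y < ireg s1 x)%N -> runs c s1 t1 s2 ->
    runs (While x y c) s2 t2 s3 -> runs (While x y c) s1 (t1 + t2).+2 s3.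

Lemma stepsS prog t s :
  steps prog t.+1 s = obind (steps prog t) (step prog s).
Proof. by []. Qed.

Lemma steps_add prog t1 t2 s :
  steps prog (t1 + t2) s = obind (steps prog t2) (steps prog t1 s).
Proof. by elim: t1 s => //= t1 IH s; case: (step prog s). Qed.

#[local] Arguments steps : simpl never.

(** Induction on the derivation. The costs in [runs] count the jumps of the compiled code: a then
    branch pays for the test only, an else branch also for the jump over the then branch, and a loop
    round for the test and the jump back. *)
Lemma runs_steps prog c s t s' :
  runs c s t s' -> forall a, code_at prog a (compile a c) ->
  steps prog t (goto s a) = Some (goto s' (a + len c)).
Proof.
elim=> {c s t s'} /=.
- by move=> s a _; rewrite addn0.
- move=> i s si a [ia _]; rewrite stepsS /step /= ia /= addn1.
  by case: i si {ia}.
- move=> c1 c2 s1 s2 s3 t1 t2 _ IH1 _ IH2 a /code_at_cat[/IH1 e1].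
  by rewrite size_compile => /IH2 e2; rewrite steps_add e1 /= e2 addnA.
- move=> x y c1 c2 s1 s2 t xy _ IH a [ia /code_at_cat[_ /= [_]]].
  rewrite size_compile => /IH e.
  rewrite stepsS /step /= ia /= xy [LHS]e.
  by congr (Some (goto _ _)); lia.
- move=> x y c1 c2 s1 s2 t xy _ IH a [ia /code_at_cat[/IH e /= [ja _]]].
  rewrite size_compile in ja.
  rewrite -(addn1 t.+1) addSn stepsS /step /= ia /= (negPf xy).
  rewrite steps_add [steps prog t _]e /= stepsS /step /= ja.
  by congr (Some (goto _ _)); lia.
- move=> x y c s xy a [ia _]; rewrite stepsS /step /= ia /= xy.
  by congr (Some (goto _ _)); lia.
- move=> x y c s1 s2 s3 t1 t2 xy _ IH1 _ IH2 a ca.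
  have [ia /code_at_cat[/IH1 e /= [ja _]]] := ca.
  rewrite size_compile in ja.
  rewrite stepsS -addnS /step /= ia /= leqNgt xy.
  rewrite steps_add [steps prog t1 _]e /= stepsS /step /= ja.
  by rewrite [LHS]IH2.
Qed.

Lemma runs_halts c s t s' :
  runs c s t s' -> pc s = 0%N ->
  halts_in (compile 0 c) s t (goto s' (len c)).
Proof.
move=> cs s0.
have sE : s = goto s 0 by case: s s0 {cs} => /= ? ? ? ? ? ->.
split; last first.
  by rewrite /step /= -(size_compile 0) onth_default.
by rewrite {1}sE; apply: (runs_steps cs); apply: code_at_self.
Qed.

(** * Loop-free code on the real registers, and cost bounds *)

Definition xinstr (i : instr) : bool :=
  match i with
  | RConst _ _ | RAdd _ _ _ | RSub _ _ _ | RMul _ _ _ | RDiv _ _ _ => true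
  | _ => false
  end.

Fixpoint xonly c : bool :=
  match c with
  | Skip => true
  | Prim i => xinstr i
  | Seq c1 c2 | IfR _ _ c1 c2 => xonly c1 && xonly c2
  | While _ _ _ => false
  end.

Definition xinstr_eval (i : instr) (X : nat -> R) : nat -> R :=
  match i with
  | RConst d k => upd X d k%:R
  | RAdd d a b => upd X d (X a + X b)
  | RSub d a b => upd X d (X a - X b)
  | RMul d a b => upd X d (X a * X b)
  | RDiv d a b => upd X d (X a / X b)
  | _ => X
  end.

Fixpoint xeval c (X : nat -> R) : nat -> R :=
  match c with
  | Prim i => xinstr_eval i X
  | Seq c1 c2 => xeval c2 (xeval c1 X)
  | IfR x y c1 c2 => if X x <= X y then xeval c1 X else xeval c2 X
  | _ => X
  end.

(** For loop-free code this bounds the running time; with unnested loops it is the coefficient of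
    [n + 1]. At most [n] rounds of cost [b], each with a test and a jump back, and a last test take
    at most [(b + 2) n + 1] steps, whence the [+ 3]. *)
Fixpoint bound c : nat :=
  match c with
  | Skip => 0
  | Prim _ => 1
  | Seq c1 c2 => bound c1 + bound c2
  | IfR _ _ c1 c2 => (bound c1 + bound c2).+2
  | While _ _ c1 => (bound c1).+3
  end.

Definition xstate s (X : nat -> R) s' : Prop :=
  [/\ ireg s' = ireg s, xreg s' = X, imem s' = imem s & xmem s' = xmem s].

Lemma runs_xonly c s : xonly c ->
  exists t s',
    [/\ runs c s t s', xstate s (xeval c (xreg s)) s' & (t <= bound c)%N].
Proof.
elim: c s => [|i|c1 IH1 c2 IH2|x y c1 IH1 c2 IH2|] //= s.
- by move=> _; exists 0%N, s; split=> //; exact: RunSkip.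
- move=> xi; exists 1%N, (exec_instr i s); split=> //.
    by apply: RunPrim; case: i xi.
  by case: i xi.
- case/andP=> x1 x2; have [t1 [s1 [r1 [i1 X1 m1 n1] l1]]] := IH1 s x1.
  have [t2 [s2 [r2 [i2 X2 m2 n2] l2]]] := IH2 s1 x2.
  exists (t1 + t2)%N, s2; split; [exact: RunSeq r1 r2| |exact: leq_add].
  by split; rewrite ?i2 ?X2 ?X1 ?m2 ?n2.
- case/andP=> x1 x2; case: ifP => xy.
    have [t1 [s1 [r1 e1 l1]]] := IH1 s x1.
    by exists t1.+1, s1; split; [exact: RunIfThen|by []|lia].
  have [t1 [s1 [r1 e1 l1]]] := IH2 s x2.
  by exists t1.+2, s1; split; [exact: RunIfElse (negbT xy) r1|by []|lia].
Qed.

End Semantics.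

(** * Dominating with two extreme points and two clusters *)

Section Geometry.
Context {R : realType}.
Implicit Types (p q e f g v : R * R).

(** The machine has no square root, so the geometry and the program both use squared distances. *)
Definition sqdist p q : R :=
  (p.1 - q.1) * (p.1 - q.1) + (p.2 - q.2) * (p.2 - q.2).

Lemma dist_le p q (r : R) : 0 <= r -> (dist p q <= r) = (sqdist p q <= r ^+ 2).
Proof.
move=> r0; rewrite /dist -[in LHS](ger0_norm r0) -(sqrtr_sqr r).
by rewrite ler_sqrt ?sqr_ge0 // /sqdist -!expr2.
Qed.

(** With [p] at the origin, [e - p] points along [(1, 0)] and [f - p] along [(-c, d)]; [(x, y)] and
    [(x', y')] are points missed by both [e] and [f]. If [c >= 4/5], the sign of [y] separates the
    two arcs; otherwise both coordinates are at most 3/40 and the diagonal halves the arc. Each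
    cluster fits into a box of diagonal at most 1.9. *)
Lemma box_clusters (c d x y x' y' : R) :
  0 <= c -> 0 <= d -> c ^+ 2 + d ^+ 2 = 1 ->
  x <= 1/40 -> - c * x + d * y <= 1/40 -> 379/100 <= x ^+ 2 + y ^+ 2 <= 4 ->
  x' <= 1/40 -> - c * x' + d * y' <= 1/40 ->
  379/100 <= x' ^+ 2 + y' ^+ 2 <= 4 ->
  (if 4/5 <= c then 0 <= y else x <= y) =
  (if 4/5 <= c then 0 <= y' else x' <= y') ->
  (x - x') ^+ 2 + (y - y') ^+ 2 <= 361/100.
Proof.
have sq (z b : R) : 0 <= b -> z ^+ 2 <= b ^+ 2 -> - b <= z <= b.
  by move=> b0 zb; rewrite -ler_norml -(@ler_pXn2r _ 2) ?nnegrE // real_normK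
    ?num_real.
have sqN (z b : R) : 0 <= b -> b ^+ 2 <= z ^+ 2 -> z < b -> z <= - b.
  by move=> b0 zb lt; rewrite leNgt; apply/negP => ?; nra.
have final (z z' w w' a b u v : R) : a <= z <= b -> a <= z' <= b ->
    u <= w <= v -> u <= w' <= v -> (b - a) ^+ 2 + (v - u) ^+ 2 <= 361/100 ->
    (z - z') ^+ 2 + (w - w') ^+ 2 <= 361/100.
  move=> /andP[? ?] /andP[? ?] /andP[? ?] /andP[? ?]; apply: le_trans.
  by apply: lerD; nra.
move=> c0 d0 cd.
have bnd (z w : R) : 379/100 <= z ^+ 2 + w ^+ 2 <= 4 ->
  (-2 <= z <= 2) /\ (-2 <= w <= 2).
  case/andP=> ? ?; have /andP[? ?] : - 2 <= z <= 2 by apply: sq; nra.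
  have /andP[? ?] : - 2 <= w <= 2 by apply: sq; nra.
  by split; apply/andP; split; lra.
case: (leP (4/5) c) => cc.
- have d35 : d <= 3/5 by nra.
  have up (z w : R) : z <= 1/40 -> - c * z + d * w <= 1/40 ->
      379/100 <= z ^+ 2 + w ^+ 2 <= 4 -> 0 <= w ->
      (-1/32 <= z <= 1/32) /\ (19/10 <= w <= 2).
    move=> z1 zw r w0; have [/andP[? ?] /andP[? ?]] := bnd _ _ r.
    have dw : 0 <= d * w by apply: mulr_ge0.
    have z0 : -1/32 <= z by rewrite leNgt; apply/negP => ?; nra.
    by case/andP: r => r1 r2; split; apply/andP; split; nra.
  (* Here [d * w >= -6/5], so [z >= -(6/5 + 1/40) / (4/5) = -1.53125], and then
     [w ^+ 2 >= 3.79 - 1.532 ^+ 2 > (6/5) ^+ 2]. *)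
  have down (z w : R) : z <= 1/40 -> - c * z + d * w <= 1/40 ->
      379/100 <= z ^+ 2 + w ^+ 2 <= 4 -> w < 0 ->
      (-1532/1000 <= z <= 1/40) /\ (-2 <= w <= -6/5).
    move=> z1 zw r w0; have [/andP[? ?] /andP[? ?]] := bnd _ _ r.
    have dw : - (6/5) <= d * w by nra.
    have z0 : -1532/1000 <= z by rewrite leNgt; apply/negP => ?; nra.
    case/andP: r => r1 r2; split; apply/andP; split=> //.
    have : w <= - (6/5) by apply: sqN; nra.
    by lra.
  move=> x1 xy r x1' xy' r'; case: (leP 0 y) => y0;
    case: (leP 0 y') => y0' // _.
    have [h1 h2] := up _ _ x1 xy r y0; have [h1' h2'] := up _ _ x1' xy' r' y0'.
    by apply: (final _ _ _ _ _ _ _ _ h1 h1' h2 h2'); clear; lra.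
  have [h1 h2] := down _ _ x1 xy r y0; have [h1' h2'] :=
    down _ _ x1' xy' r' y0'.
  by apply: (final _ _ _ _ _ _ _ _ h1 h1' h2 h2'); clear; lra.
- have d35 : 3/5 <= d by nra.
  have yle (z w : R) : z <= 1/40 -> - c * z + d * w <= 1/40 -> w <= 3/40.
    move=> z1 zw; rewrite leNgt; apply/negP => ?.
    have : c * z <= 1/50 by nra.
    by nra.
  (* For [w <= 0], [z ^+ 2] is at least half of 3.79 and [w ^+ 2] at most half of 4, which gives
     1.37 and 1.415; a positive [w] is at most 3/40 and forces [z] even further out. The other half
     of the arc follows by exchanging the coordinates. *)
  have oct (z w : R) : z <= 3/40 -> w <= 3/40 ->
    379/100 <= z ^+ 2 + w ^+ 2 <= 4 ->
      z <= w -> (-2 <= z <= -137/100) /\ (-1415/1000 <= w <= 3/40).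
    move=> z1 w1 r zw; have [/andP[? ?] /andP[? ?]] := bnd _ _ r.
    case/andP: r => r1 r2; split; apply/andP; split=> //.
      have : z <= - (137/100).
        by apply: sqN; [lra| |lra]; case: (leP 0 w) => ?; nra.
      by lra.
    by case: (leP 0 w) => ?; [lra|rewrite leNgt; apply/negP => ?; nra].
  move=> x1 xy r x1' xy' r'.
  have y1 := yle _ _ x1 xy; have y1' := yle _ _ x1' xy'.
  have x2 : x <= 3/40 by lra.
  have x2' : x' <= 3/40 by lra.
  case: (leP x y) => o; case: (leP x' y') => o' // _.
    have [h1 h2] := oct _ _ x2 y1 r o; have [h1' h2'] := oct _ _ x2' y1' r' o'.
    by apply: (final _ _ _ _ _ _ _ _ h1 h1' h2 h2'); clear; lra.
  rewrite addrC in r; rewrite addrC in r'; rewrite addrC.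
  have [h1 h2] := oct _ _ y1 x2 r (ltW o).
  have [h1' h2'] := oct _ _ y1' x2' r' (ltW o').
  by apply: (final _ _ _ _ _ _ _ _ h1 h1' h2 h2'); clear; lra.
Qed.

Definition missed p e q : bool := (sqdist p q <= 4) && (4 < sqdist e q).

(** A rotation, with a reflection if necessary, brings the points into the position of
    [box_clusters]. The colouring [k] names the cluster of a point. *)
Lemma missed_clusters p e f :
  sqdist e p <= 1/400 -> sqdist f p <= 1/400 ->
  (e.1 - p.1) * (f.1 - p.1) + (e.2 - p.2) * (f.2 - p.2) <= 0 ->
  exists k : R * R -> bool, forall q q',
    missed p e q -> missed p f q -> missed p e q' -> missed p f q' ->
    k q = k q' -> sqdist q q' <= 361/100.
Proof.
case: p e f => p1 p2 [e1 e2] [f1 f2]; rewrite /missed /sqdist /=.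
set a1 := e1 - p1; set a2 := e2 - p2; set b1 := f1 - p1; set b2 := f2 - p2.
move=> an bn ab.
pose n := Num.sqrt (a1 * a1 + a2 * a2); pose m := Num.sqrt (b1 * b1 + b2 * b2).
have n2 : n * n = a1 * a1 + a2 * a2.
  by rewrite -expr2 sqr_sqrtr //; nra.
have m2 : m * m = b1 * b1 + b2 * b2.
  by rewrite -expr2 sqr_sqrtr //; nra.
have n0 : 0 <= n by apply: sqrtr_ge0.
have m0 : 0 <= m by apply: sqrtr_ge0.
have n20 : n <= 1/20 by nra.
have m20 : m <= 1/20 by nra.
(* If [e = p], then [e] misses nothing that [p] dominates and any colouring works; likewise for
   [f]. *)
case: (eqVneq n 0) => [nz|nz].
  exists (fun=> true) => -[q1 q2] q' /= /andP[c1 c2].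
  have [a10 a20] : a1 = 0 /\ a2 = 0 by rewrite nz in n2; split; nra.
  have ee : e1 = p1 /\ e2 = p2 by rewrite /a1 /a2 in a10 a20; split; lra.
  by case: ee c2 => -> ->; rewrite ltNge c1.
case: (eqVneq m 0) => [mz|mz].
  exists (fun=> true) => -[q1 q2] q' _ /= /andP[c1 c2].
  have [a10 a20] : b1 = 0 /\ b2 = 0 by rewrite mz in m2; split; nra.
  have ee : f1 = p1 /\ f2 = p2 by rewrite /b1 /b2 in a10 a20; split; lra.
  by case: ee c2 => -> ->; rewrite ltNge c1.
have npos : 0 < n by rewrite lt0r nz.
have mpos : 0 < m by rewrite lt0r mz.
pose u1 := a1 / n; pose u2 := a2 / n; pose w1 := b1 / m; pose w2 := b2 / m.
have ea1 : a1 = n * u1 by rewrite /u1; field.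
have ea2 : a2 = n * u2 by rewrite /u2; field.
have eb1 : b1 = m * w1 by rewrite /w1; field.
have eb2 : b2 = m * w2 by rewrite /w2; field.
have uu : u1 ^+ 2 + u2 ^+ 2 = 1.
  apply: (mulfI (mulf_neq0 nz nz)); rewrite mulr1 {2}n2 ea1 ea2; ring.
have ww : w1 ^+ 2 + w2 ^+ 2 = 1.
  apply: (mulfI (mulf_neq0 mz mz)); rewrite mulr1 {2}m2 eb1 eb2; ring.
(* [c] is minus the cosine of the angle between the two directions and [cr] is its sine; the sign
   [sg] orients the second axis so that [d] is nonnegative. *)
pose c := - (u1 * w1 + u2 * w2).
have c0 : 0 <= c.
  have E : a1 * b1 + a2 * b2 = - (n * m * c) by rewrite ea1 ea2 eb1 eb2 /c;
    ring.
  rewrite E oppr_le0 in ab; by rewrite pmulr_rge0 in ab; rewrite ?mulr_gt0.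
pose cr := u1 * w2 - u2 * w1.
have [sg [d [sg2 d0 ed]]] : exists sg d : R, [/\ sg ^+ 2 = 1, 0 <= d &
  cr = sg * d].
  case: (leP 0 cr) => h; first by exists 1, cr; split; [ring|by []|ring].
  by exists (-1), (- cr); split; [ring|lra|ring].
have cd : c ^+ 2 + d ^+ 2 = 1.
  have -> : d ^+ 2 = cr ^+ 2 by rewrite ed exprMn sg2 mul1r.
  rewrite -[RHS]mulr1 -{1}uu -ww /c /cr; ring.
pose X (q : R * R) := (q.1 - p1) * u1 + (q.2 - p2) * u2.
pose Y (q : R * R) := sg * ((q.2 - p2) * u1 - (q.1 - p1) * u2).
have XY q : X q ^+ 2 + Y q ^+ 2 = (q.1 - p1) ^+ 2 + (q.2 - p2) ^+ 2.
  rewrite /Y exprMn sg2 mul1r -[RHS]mulr1 -uu /X; ring.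
have fx q : - c * X q + d * Y q = (q.1 - p1) * w1 + (q.2 - p2) * w2.
  have -> : d * Y q = cr * ((q.2 - p2) * u1 - (q.1 - p1) * u2).
    by rewrite /Y ed; ring.
  transitivity (((q.1 - p1) * w1 + (q.2 - p2) * w2) * (u1 ^+ 2 + u2 ^+ 2)).
    rewrite /c /X /cr; ring.
  by rewrite uu mulr1.
(* Let [r] be the distance from [p] to [q]. Then [r^2 - 2 n X + n^2 > 4 >= r^2] gives
   [X < n / 2 <= 1/40], and with [X >= -2] also [r^2 > 4 - 4 n - n^2 >= 3.7975]. *)
have main q : missed (p1, p2) (e1, e2) q -> missed (p1, p2) (f1, f2) q ->
    [/\ X q <= 1/40, - c * X q + d * Y q <= 1/40 &
        379/100 <= X q ^+ 2 + Y q ^+ 2 <= 4].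
  rewrite /missed /sqdist /= => /andP[h1 h2] /andP[_ h3].
  have r4 : X q ^+ 2 + Y q ^+ 2 <= 4 by rewrite XY; lra.
  have E : (e1 - q.1) * (e1 - q.1) + (e2 - q.2) * (e2 - q.2) =
      X q ^+ 2 + Y q ^+ 2 - 2 * n * X q + n * n.
    rewrite XY n2 /X; have -> : 2 * n * ((q.1 - p1) * u1 + (q.2 - p2) * u2) =
      2 * ((q.1 - p1) * a1 + (q.2 - p2) * a2) by rewrite ea1 ea2; ring.
    rewrite /a1 /a2; ring.
  have F : (f1 - q.1) * (f1 - q.1) + (f2 - q.2) * (f2 - q.2) =
      X q ^+ 2 + Y q ^+ 2 - 2 * m * (- c * X q + d * Y q) + m * m.
    rewrite XY m2 fx; have -> : 2 * m * ((q.1 - p1) * w1 + (q.2 - p2) * w2) =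
      2 * ((q.1 - p1) * b1 + (q.2 - p2) * b2) by rewrite eb1 eb2; ring.
    rewrite /b1 /b2; ring.
  rewrite E in h2; rewrite F in h3.
  set x := X q in r4 h2 h3 *; set y := Y q in r4 h2 h3 *.
  set z := - c * x + d * y in h3 *.
  have xm2 : -2 <= x by rewrite leNgt; apply/negP => ?; nra.
  split.
  - have : 0 < n * (n - 2 * x) by lra.
    by rewrite pmulr_rgt0 // => ?; lra.
  - have : 0 < m * (m - 2 * z) by lra.
    by rewrite pmulr_rgt0 // => ?; lra.
  - apply/andP; split=> //.
    have : 0 <= n * (x + 2) by apply: mulr_ge0; lra.
    by nra.
exists (fun q => if 4/5 <= c then 0 <= Y q else X q <= Y q) => q q'.
move=> /main h /h[x1 x2 x3] /main h' /h'[y1 y2 y3] ek.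
have := box_clusters c0 d0 cd x1 x2 x3 y1 y2 y3 ek.
have -> : (X q - X q') ^+ 2 + (Y q - Y q') ^+ 2 = sqdist q q'.
  rewrite [RHS](_ : _ = (sqdist q q') * (u1 ^+ 2 + u2 ^+ 2));
    last by rewrite uu mulr1.
  have -> : (Y q - Y q') ^+ 2 =
      ((q.2 - q'.2) * u1 - (q.1 - q'.1) * u2) ^+ 2.
    rewrite -[RHS]mul1r -sg2 /Y; ring.
  rewrite /X /sqdist; ring.
by [].
Qed.

(* If all six inner products were positive, [t.1] and [b.1] would have the same
   sign, and so would [l.2] and [r.2], which forces a nonpositive product
   between one of [t], [b] and one of [l], [r]. *)
Lemma extremes_pair (E : bool * bool -> R * R) p :
  (E (false, false)).1 <= p.1 -> p.1 <= (E (false, true)).1 ->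
  (E (true, false)).2 <= p.2 -> p.2 <= (E (true, true)).2 ->
  exists i j, ((E i).1 - p.1) * ((E j).1 - p.1) +
              ((E i).2 - p.2) * ((E j).2 - p.2) <= 0.
Proof.
case el: (E (false, false)) => [l1 l2] /= hl.
case er: (E (false, true)) => [r1 r2] /= hr.
case eb: (E (true, false)) => [b1 b2] /= hb.
case et: (E (true, true)) => [t1 t2] /= ht.
have pick i j (x y x' y' : R) : E i = (x, y) -> E j = (x', y') ->
    (x - p.1) * (x' - p.1) + (y - p.2) * (y' - p.2) <= 0 ->
  exists i j, ((E i).1 - p.1) * ((E j).1 - p.1) +
              ((E i).2 - p.2) * ((E j).2 - p.2) <= 0.
  by move=> Ei Ej h; exists i, j; rewrite Ei Ej.
case: (leP ((l1 - p.1) * (r1 - p.1) + (l2 - p.2) * (r2 - p.2)) 0) => lr;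
  first exact: (pick _ _ _ _ _ _ el er).
case: (leP ((t1 - p.1) * (b1 - p.1) + (t2 - p.2) * (b2 - p.2)) 0) => tb;
  first exact: (pick _ _ _ _ _ _ et eb).
case: (leP 0 (t1 - p.1)) => st; case: (leP 0 (l2 - p.2)) => sl.
- apply: (pick _ _ _ _ _ _ el eb); have : 0 < b1 - p.1 by nra.
  by nra.
- apply: (pick _ _ _ _ _ _ el et); nra.
- apply: (pick _ _ _ _ _ _ er eb).
  have : b1 - p.1 < 0 by nra.
  have : 0 < r2 - p.2 by nra.
  by nra.
- apply: (pick _ _ _ _ _ _ er et).
  have : r2 - p.2 < 0 by nra.
  by nra.
Qed.

End Geometry.

(** * The coreset *)

Section Cells.
Context {R : realType}.
Implicit Types (p q g z : R * R) (s : seq (R * R)) (d : bool * bool).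

(** The first bit of [d] selects the axis and the second the side; negating the coordinate lets one
    maximisation serve all four sides. *)
Definition key d p : R :=
  let x := if d.1 then p.2 else p.1 in if d.2 then x else - x.

Definition in_cell (r : R) g p : bool := sqdist g p <= r.

(** The scan may start at a point outside the cell, so a point of the cell always replaces one
    outside it. For an empty cell the start value survives. *)
Definition improve r g d p q : R * R :=
  if in_cell r g q && (in_cell r g p ==> (key d p <= key d q)) then q else p.

Definition extreme r g d z s : R * R := foldl (improve r g d) z s.

Lemma extreme_mem r g d z s : extreme r g d z s \in z :: s.
Proof.
elim: s z => [|q s IH] z; first by rewrite mem_seq1.
rewrite /extreme /= -/(extreme r g d _ s).
have := IH (improve r g d z q); set e := extreme _ _ _ _ _.
by rewrite !inE /improve; case: ifP => _ /orP[->|->]; rewrite ?orbT.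
Qed.

Lemma extreme_max r g d z s p : p \in z :: s -> in_cell r g p ->
  in_cell r g (extreme r g d z s) && (key d p <= key d (extreme r g d z s)).
Proof.
elim: s z p => [|q s IH] z p.
  by rewrite mem_seq1 => /eqP -> gz; rewrite /= gz lexx.
have [ps _ gp|nps] := boolP (p \in s); first by apply: IH;
  rewrite // inE ps orbT.
rewrite !inE (negPf nps) orbF => pzq gp; rewrite /extreme /= -/(extreme r g d _
  s).
have /andP[gi ki] : in_cell r g (improve r g d z q) &&
    (key d p <= key d (improve r g d z q)).
  rewrite /improve; case/orP: pzq => /eqP <-; rewrite gp /=.
    by case: ifP => [/andP[-> ->]//|_]; rewrite gp lexx.
  case: ifP => [|/negbT]; first by rewrite gp lexx.
  by rewrite negb_imply -ltNge => /andP[-> /ltW].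
have /andP[ge ke] := IH _ _ (mem_head (improve r g d z q) s) gi.
by rewrite ge (le_trans ki ke).
Qed.

Definition grid (M : nat) z (a b : nat) : R * R :=
  (z.1 - M%:R + a%:R / 100%:R, z.2 - M%:R + b%:R / 100%:R).

(** Cells are overlapping discs, so that membership is a single comparison. Radius [sqrt 2 / 100]
    makes the disc cover the grid square whose lower left corner is its centre; the diameter is
    about 0.028. *)
Definition sqradius : R := 2%:R / 100%:R / 100%:R.

Definition spec : Type := (nat * nat * (bool * bool))%type.

Definition specs (M : nat) : seq spec :=
  let I := iota 0 (200 * M).+1 in
  [seq (ab, d) | ab <- [seq (a, b) | a <- I, b <- I],
                 d <- [seq (x, y) | x <- [:: false; true], y <- [:: false;
                   true]]].

Definition slot_point M z s (sp : spec) : R * R :=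
  extreme sqradius (grid M z sp.1.1 sp.1.2) sp.2 z s.

(** [a] is the integer part of [100 (y - x + M)], which lies between 0 and [200 M]. *)
Lemma grid_coord (M : nat) (x y : R) : `|y - x| <= M%:R ->
  exists2 a, (a < (200 * M).+1)%N &
    0 <= y - (x - M%:R + a%:R / 100%:R) <= 1/100.
Proof.
rewrite ler_norml => /andP[h1 h2].
set u := (y - x + M%:R) * 100.
have u0 : 0 <= u by rewrite /u; lra.
have /andP[t1 t2] := truncn_itv u0.
exists (Num.truncn u).
  rewrite ltnS -(ler_nat R); apply: le_trans t1 _.
  by rewrite natrM /u; lra.
rewrite -natr1 in t2; rewrite /u in t1 t2 *.
by apply/andP; split; lra.
Qed.

Lemma grid_cell (M : nat) z p : `|p.1 - z.1| <= M%:R -> `|p.2 - z.2| <= M%:R ->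
  exists ab : nat * nat, (forall d, (ab, d) \in specs M) /\
    in_cell sqradius (grid M z ab.1 ab.2) p.
Proof.
move=> /grid_coord[a aM /andP[a1 a2]] /grid_coord[b bM /andP[b1 b2]].
exists (a, b); split.
  move=> d; apply: allpairs_f; last by case: d => -[] [].
  by apply: allpairs_f; rewrite mem_iota.
rewrite /in_cell /sqdist /sqradius /=.
set x := z.1 - _ + _ in a1 a2 *; set y := z.2 - _ + _ in b1 b2 *.
have : (x - p.1) * (x - p.1) <= 1/100 * (1/100) by nra.
have : (y - p.2) * (y - p.2) <= 1/100 * (1/100) by nra.
by lra.
Qed.

Lemma in_cell_close g p q :
  in_cell sqradius g p -> in_cell sqradius g q -> sqdist p q <= 1/400.
Proof.
case: g p q => g1 g2 [p1 p2] [q1 q2]; rewrite /in_cell /sqdist /sqradius /= => h1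
  h2.
have sq (x y w : R) : (y - w) * (y - w) <= 2 * ((x - y) * (x - y)) + 2 * ((x -
  w) * (x - w)).
  by have := sqr_ge0 (x - y + (x - w)); nra.
have := sq g1 p1 q1; have := sq g2 p2 q2; lra.
Qed.

Lemma sqdist_near p q v : sqdist p q <= 361/100 -> sqdist v p <= 1/400 ->
  sqdist v q <= 4.
Proof.
case: p q v => p1 p2 [q1 q2] [v1 v2]; rewrite /sqdist /= => h1 h2.
(* This is [(a + b)^2 <= (1 + 1/10) a^2 + (1 + 10) b^2]; with 3.61 and 1/400 the right-hand side
   becomes 3.9985. *)
have sq (x y w : R) : (w - y) * (w - y) <= 11/10 * ((x - y) * (x - y)) + 11 *
  ((w - x) * (w - x)).
  by have := sqr_ge0 (x - y - 10 * (w - x)); nra.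
have := sq p1 q1 v1; have := sq p2 q2 v2; lra.
Qed.

Section FourCover.
Variables (M : nat) (z : R * R) (s s' : seq (R * R)).
Hypothesis sM : forall p, p \in s -> `|p.1 - z.1| <= M%:R /\ `|p.2 - z.2| <=
  M%:R.
Hypothesis ss' : {subset s' <= s}.
Let v := slot_point M z s.

(* Two extreme points of the cell of [p] at a right or obtuse angle from [p]
   miss at most two clusters of points dominated by [p]; one representative of
   the cell of any point of a cluster dominates the whole cluster. *)
Lemma four_cover p : p \in s -> exists S : seq spec,
  [/\ {subset S <= specs M}, (size S <= 4)%N &
      {in s', forall q, sqdist p q <= 4 -> has (fun k => sqdist (v k) q <= 4)
        S}].
Proof.
move=> ps; have [/grid_cell h /h[ab [abM gp]]] := sM ps.
set g := grid M z ab.1 ab.2 in gp.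
have near d : sqdist (v (ab, d)) p <= 1/400 /\ key d p <= key d (v (ab, d)).
  have /andP[c k] := extreme_max d (@mem_behead _ (z :: s) _ ps) gp.
  by split=> //; apply: in_cell_close c gp.
have [||||i [j ij]] := @extremes_pair _ (fun d => v (ab, d)) p.
- by have [_] := near (false, false); rewrite /key /= lerN2.
- by have [_] := near (false, true).
- by have [_] := near (true, false); rewrite /key /= lerN2.
- by have [_] := near (true, true).
have [k kP] := missed_clusters (near i).1 (near j).1 ij.
pose miss q := missed p (v (ab, i)) q && missed p (v (ab, j)) q.
(* [b] selects a cluster. An empty cluster needs no point; otherwise the cell of any member [q0]
   supplies one, and the direction [i] is an arbitrary choice. *)
have rep b : exists S : seq spec, [/\ {subset S <= specs M}, (size S <= 1)%N &
    {in s', forall q, miss q -> k q = b -> has (fun k => sqdist (v k) q <= 4)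
      S}].
  have [/hasP[q0 q0s /andP[/andP[m1 m2] /eqP kq0]]|/hasPn no] :=
      boolP (has (fun q => miss q && (k q == b)) s'); last first.
    by exists [::]; split=> // q /no/negP n mq kq; case: n; rewrite mq kq eqxx.
  have [/grid_cell h' /h'[cd [cdM gq]]] := sM (ss' q0s).
  exists [:: (cd, i)]; split=> // [x|q qs /andP[n1 n2] kq].
    by rewrite mem_seq1 => /eqP ->.
  rewrite /= orbF; apply: (@sqdist_near q0).
    by apply: kP => //; rewrite kq.
  have /andP[c _] := extreme_max i (@mem_behead _ (z :: s) _ (ss' q0s)) gq.
  exact: in_cell_close c gq.
have [S1 [S1M S1s S1P]] := rep true; have [S2 [S2M S2s S2P]] := rep false.
exists ([:: (ab, i); (ab, j)] ++ S1 ++ S2); split.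
- move=> x; rewrite 2!mem_cat mem_seq2.
  by case/or3P=> [/orP[]/eqP ->|/S1M|/S2M] //; apply: abM.
- by rewrite !size_cat /=; lia.
- move=> q qs pq; rewrite /= !has_cat.
  case: (leP (sqdist (v (ab, i)) q) 4) => //= vi.
  case: (leP (sqdist (v (ab, j)) q) 4) => //= vj.
  have mq : miss q by rewrite /miss /missed pq vi vj.
  case kq: (k q); first by rewrite (S1P q qs mq kq).
  by rewrite (S2P q qs mq kq) orbT.
Qed.

Lemma cover_all (D : seq (R * R)) : {subset D <= s} ->
  (forall q, q \in s' -> exists2 p, p \in D & sqdist p q <= 4) ->
  exists S : seq spec, [/\ {subset S <= specs M}, (size S <= 4 * size D)%N &
    {in s', forall q, has (fun k => sqdist (v k) q <= 4) S}].
Proof.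
move=> Ds cov.
(* Naming the member of [D] that dominates [q] lets the induction run over [D] although its tail
   need not dominate [s']. *)
suff [S [SM Ss SP]] : exists S : seq spec,
    [/\ {subset S <= specs M}, (size S <= 4 * size D)%N &
      {in s', forall q, forall p, p \in D -> sqdist p q <= 4 ->
         has (fun k => sqdist (v k) q <= 4) S}].
  exists S; split=> // q qs; have [p pD pq] := cov q qs; exact: SP pq.
elim: D Ds {cov} => [|p D IH] Ds; first by exists [::].
have [|S [SM Ss SP]] := IH; first by move=> x xD; apply: Ds;
  rewrite inE xD orbT.
have [S1 [S1M S1s S1P]] := four_cover (Ds p (mem_head _ _)).
exists (S1 ++ S); split.
- by move=> x; rewrite mem_cat => /orP[/S1M|/SM].
- by rewrite size_cat /=; lia.
- move=> q qs p'; rewrite inE has_cat => /predU1P[->|pD] h.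
    by rewrite S1P.
  by rewrite (SP _ qs _ pD h) orbT.
Qed.

End FourCover.
End Cells.

(** * The program *)

(* Register conventions.  Real registers: 0 and 1 hold the point being scanned,
   2 and 3 are scratch (2 receives squared distances), 4 and 5 hold a grid
   point, 6 a threshold, 7 a truth value, 8 and 9 the first input point (8 is later
   reused for the constant 1); the candidate points follow from register 10 on.
   Natural-number registers: 2 holds 1, 3 the scan pointer, 4 and 5 the ends of
   the two input lists. *)
Definition block (l : seq instr) : cmd := foldr (fun i c => Seq (Prim i) c)
  Skip l.

Definition slotx (k : nat) : nat := k.*2.+4.+4.+2.
Definition sloty (k : nat) : nat := k.*2.+4.+4.+3.

Definition sqdist_cmd (a b c e : nat) : cmd :=
  block [:: RSub 2 a c; RMul 2 2 2; RSub 3 b e; RMul 3 3 3; RAdd 2 2 3].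

Definition keep_cmd (k : nat) : cmd :=
  block [:: RConst (slotx k) 0; RAdd (slotx k) (slotx k) 0;
            RConst (sloty k) 0; RAdd (sloty k) (sloty k) 1].

Definition compare_cmd (k : nat) (d : bool * bool) (c : cmd) : cmd :=
  let p := if d.1 then sloty k else slotx k in
  let q := if d.1 then 1%N else 0%N in
  if d.2 then IfR p q c Skip else IfR q p c Skip.

Definition improve_cmd (k : nat) (d : bool * bool) : cmd :=
  Seq (sqdist_cmd 4 5 0 1)
    (IfR 2 6
       (Seq (sqdist_cmd 4 5 (slotx k) (sloty k))
          (IfR 2 6 (compare_cmd k d (keep_cmd k)) (keep_cmd k)))
       Skip).

(** Register 7 is only ever cleared here, so after a scan it tells whether every point was
    covered. *)
Fixpoint cover_cmd (w : seq nat) : cmd :=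
  if w is k :: w' then
    Seq (sqdist_cmd (slotx k) (sloty k) 0 1) (IfR 2 6 Skip (cover_cmd w'))
  else Prim (RConst 7 0).

Definition scan_cmd (e : nat) (c : cmd) : cmd :=
  While e 3 (Seq (Prim (RLoad 0 3)) (Seq (Prim (IAdd 3 3 2))
            (Seq (Prim (RLoad 1 3)) (Seq (Prim (IAdd 3 3 2)) c)))).

Definition coord_cmd (h e d a M : nat) : cmd :=
  block [:: RConst 3 h; RConst 0 M; RSub d e 0; RConst 2 a; RDiv 2 2 3;
    RAdd d d 2].

Definition radius_cmd (h : nat) : cmd :=
  block [:: RConst 3 h; RConst 6 2; RDiv 6 6 3; RDiv 6 6 3].

Definition reset_cmd (k : nat) : cmd :=
  block [:: RConst 0 0; RAdd (slotx k) 8 0; RAdd (sloty k) 9 0].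

Definition setup_cmd (M k : nat) (sp : spec) : cmd :=
  Seq (coord_cmd 100 8 4 sp.1.1 M) (Seq (coord_cmd 100 9 5 sp.1.2 M)
  (Seq (radius_cmd 100) (reset_cmd k))).

Definition slot_cmd (M k : nat) (sp : spec) : cmd :=
  Seq (Prim (IConst 3 0))
  (Seq (setup_cmd M k sp) (scan_cmd 4 (improve_cmd k sp.2))).

Fixpoint slots_cmd (M k : nat) (l : seq spec) : cmd :=
  if l is sp :: l' then Seq (slot_cmd M k sp) (slots_cmd M k.+1 l') else Skip.

(** The pointer starts at the end of the first list, where the second one begins. The threshold 4 is
    the squared domination radius. *)
Definition check_cmd (w : seq nat) : cmd :=
  Seq (Prim (IConst 3 0)) (Seq (Prim (IAdd 3 3 4))
  (Seq (block [:: RConst 6 4; RConst 7 1; RConst 8 1])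
       (scan_cmd 5 (cover_cmd w)))).

(** The output may overwrite the input, because nothing is read after the first success. *)
Fixpoint emit_cmd (i : nat) (w : seq nat) : cmd :=
  if w is k :: w' then
    Seq (Prim (IConst 3 i.*2)) (Seq (Prim (RStore 3 (slotx k)))
    (Seq (Prim (IConst 3 i.*2.+1)) (Seq (Prim (RStore 3 (sloty k)))
         (emit_cmd i.+1 w'))))
  else Prim (IConst 0 i).

(** The candidates are unrolled into the program text, so their number affects only the constant of
    the linear bound. *)
Fixpoint search_cmd (cs : seq (seq nat)) : cmd :=
  if cs is w :: cs' then
    Seq (check_cmd w) (IfR 8 7 (emit_cmd 0 w) (search_cmd cs'))
  else Skip.

(** A point takes two cells, hence the doubled lengths. Register 2 holds 1 and so also serves as the
    address of the first y-coordinate. *)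
Definition init_cmd : cmd :=
  block [:: IConst 2 1; IConst 3 0; IAdd 4 0 0; IAdd 5 1 1; IAdd 5 5 4;
            RLoad 8 3; RLoad 9 2].

Definition main_cmd (M : nat) (cs : seq (seq nat)) : cmd :=
  Seq init_cmd (Seq (slots_cmd M 0 (specs M)) (search_cmd cs)).

#[local] Arguments specs : simpl never.

Section Program.
Context {R : realType}.
Implicit Types (X : nat -> R) (p q g z : R * R) (s : seq (R * R)).
Implicit Types (k i j : nat).

(** * Effect of the loop-free fragments on the real registers *)

Lemma updE (T : Type) (m : nat -> T) i x j :
  upd m i x j = if j == i then x else m j.
Proof. by []. Qed.

Lemma slot_neq k j : j != k ->
  [/\ slotx j != slotx k, slotx j != sloty k, sloty j != slotx k &
      sloty j != sloty k].
Proof. by rewrite /slotx /sloty => jk; split; lia. Qed.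

Definition slot X k : R * R := (X (slotx k), X (sloty k)).

Lemma slot_ge k j : (j < 10)%N -> (j != slotx k) && (j != sloty k).
Proof. by rewrite /slotx /sloty => ?; lia. Qed.

Lemma xeval_seq (c1 c2 : cmd) X : xeval (Seq c1 c2) X = xeval c2 (xeval c1 X).
Proof. by []. Qed.

Lemma xeval_if x y (c1 c2 : cmd) X :
  xeval (IfR x y c1 c2) X = if X x <= X y then xeval c1 X else xeval c2 X.
Proof. by []. Qed.

Lemma sqdist_eval (a b c e : nat) X :
  [&& a != 2, b != 2, b != 3, c != 2, e != 2 & e != 3]%N ->
  forall X', X' = xeval (sqdist_cmd a b c e) X ->
  X' 2 = sqdist (X a, X b) (X c, X e) /\
  forall j, j != 2%N -> j != 3 -> X' j = X j.
Proof.
case/and5P=> a2 b2 b3 c2 /andP[e2 e3] _ ->; split=> [|j j2 j3].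
  by rewrite /= !updE /= (negPf b2) (negPf e2).
by rewrite /= !updE (negPf j2) (negPf j3).
Qed.

Lemma keep_eval k X :
  forall X', X' = xeval (keep_cmd k) X ->
  slot X' k = (X 0, X 1) /\
  forall j, j != slotx k -> j != sloty k -> X' j = X j.
Proof.
have xy : (slotx k == sloty k) = false by rewrite /slotx /sloty; lia.
have yx : (sloty k == slotx k) = false by rewrite eq_sym.
have /andP[/negPf x0 /negPf y0] := slot_ge k (isT : (0 < 10)%N).
have /andP[/negPf x1 /negPf y1] := slot_ge k (isT : (1 < 10)%N).
move=> _ ->; split=> [|j /negPf jx /negPf jy].
  by rewrite /slot /keep_cmd /block [foldr _ _ _]/= !xeval_seq /= !updE !(xy,
    yx, x0, x1, y0, y1, eqxx) !add0r.
by rewrite /keep_cmd /block [foldr _ _ _]/= !xeval_seq /= !updE !(jx, jy).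
Qed.

Lemma improve_eval k d X g p r :
  (X 0, X 1) = p -> (X 4, X 5) = g -> X 6 = r ->
  forall X', X' = xeval (improve_cmd k d) X ->
  slot X' k = improve r g d (slot X k) p /\
  forall j, (4 <= j)%N -> j != slotx k -> j != sloty k -> X' j = X j.
Proof.
move=> pE gE rE _ ->.
have [d1 f1] := @sqdist_eval 4 5 0 1 X isT _ erefl.
rewrite /improve_cmd xeval_seq; set X1 := xeval _ X in d1 f1 *.
have [|d2 f2] := @sqdist_eval 4 5 (slotx k) (sloty k) X1 _ _ erefl;
  first by rewrite /slotx /sloty; lia.
rewrite xeval_if d1 !f1 // pE gE rE /improve -/(in_cell r g p).
case: ifP => gp; last first.
  by rewrite andFb [xeval _ _]/=; split=> [|j j4 _ _];
    rewrite /slot ?f1 // /slotx /sloty; lia.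
rewrite andTb xeval_seq xeval_if; set X2 := xeval _ X1 in d2 f2 *.
have X2E j : (4 <= j)%N || (j < 2)%N -> X2 j = X j by move=> ?;
  rewrite f2 ?f1 //; lia.
have sX2 : slot X2 k = slot X k by rewrite /slot !X2E // /slotx /sloty; lia.
rewrite d2 !f1 ?X2E // ?gE ?rE -?/(slot X k) -?/(in_cell r g (slot X k));
  try by rewrite /slotx /sloty; lia.
have [sK fK] := keep_eval (k := k) (X := X2) erefl.
set X3 := xeval _ X2 in sK fK *.
have kept : slot X3 k = p /\ forall j, (4 <= j)%N -> j != slotx k ->
  j != sloty k -> X3 j = X j.
  by split=> [|j j4 jx jy]; [rewrite sK !X2E|rewrite fK // X2E ?j4].
case: ifP => gs; last by rewrite implyFb.
rewrite implyTb.
have -> : xeval (compare_cmd k d (keep_cmd k)) X2 =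
    if key d (slot X k) <= key d p then X3 else X2.
  rewrite /compare_cmd -sX2 -pE -(X2E 0%N) // -(X2E 1%N) // /key.
  by case: d => -[] []; rewrite xeval_if //= lerN2.
case: ifP => _; first exact: kept.
by split=> // j j4 _ _; rewrite X2E ?j4.
Qed.

Lemma cover_eval (w : seq nat) X p : (X 0, X 1) = p -> X 6 = 4%:R ->
  forall X', X' = xeval (cover_cmd w) X ->
  X' 7 = (if has (fun k => sqdist (slot X k) p <= 4) w then X 7 else 0) /\
  forall j, (4 <= j)%N -> j != 7 -> X' j = X j.
Proof.
elim: w X => [|k w IH] X pE X6 _ ->.
  by split=> [|j j4 /negPf j7]; rewrite /= updE ?j7.
rewrite [cover_cmd _]/= xeval_seq xeval_if.
have [|d f] := @sqdist_eval (slotx k) (sloty k) 0 1 X _ _ erefl;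
  first by rewrite /slotx /sloty; lia.
set X1 := xeval _ X in d f *.
have X1E j : (4 <= j)%N || (j < 2)%N -> X1 j = X j by move=> ?; rewrite f //;
  lia.
have sX1 i : slot X1 i = slot X i by rewrite /slot !X1E // /slotx /sloty; lia.
rewrite d X1E // X6 pE -/(slot X k) [has _ _]/=; case: ifP => kp.
  by rewrite orTb [xeval _ _]/=; split=> [|j j4 _]; rewrite X1E ?j4.
rewrite orFb; have [||h1 h2] := IH X1 _ _ _ erefl; rewrite ?X1E //; split.
  by rewrite h1 X1E //; under eq_has do rewrite sX1.
by move=> j j4 j7; rewrite h2 // X1E ?j4.
Qed.

Lemma coord_eval (h e d a M : nat) X :
  (3 < d)%N -> (3 < e)%N -> forall X', X' = xeval (coord_cmd h e d a M) X ->
  X' d = X e - M%:R + a%:R / h%:R /\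
  forall j, (3 < j)%N -> j != d -> X' j = X j.
Proof.
move=> d3 e3 _ ->.
have [d2 e0 e2] : [/\ (d == 2) = false, (e == 0%N) = false & (e == 3) = false].
  by split; lia.
have n3 : (3 == d)%N = false by lia.
split=> [|j j3 /negPf jd]; rewrite /= !updE /= ?updE /=.
  by rewrite !(eqxx, d2, e0, e2, n3).
by rewrite jd; case: j j3 {jd} => [|[|[|[|j]]]].
Qed.

Lemma radius_eval (h : nat) X : forall X', X' = xeval (radius_cmd h) X ->
  X' 6 = 2%:R / h%:R / h%:R /\ forall j, (3 < j)%N -> j != 6 -> X' j = X j.
Proof.
move=> _ ->; split=> [|j j3 /negPf j6]; rewrite /= !updE //.
by rewrite j6; case: j j3 {j6} => [|[|[|[|j]]]].
Qed.

Lemma reset_eval k X : forall X', X' = xeval (reset_cmd k) X ->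
  slot X' k = (X 8, X 9) /\
  forall j, j != 0%N -> j != slotx k -> j != sloty k -> X' j = X j.
Proof.
have xy : (slotx k == sloty k) = false by rewrite /slotx /sloty; lia.
have /andP[_ m0] := slot_ge k (isT : (0 < 10)%N).
have /andP[n9 _] := slot_ge k (isT : (9 < 10)%N).
have /andP[n0 _] := slot_ge k (isT : (0 < 10)%N).
rewrite /slot /reset_cmd.
move: (slotx k) (sloty k) xy m0 n0 n9 => x y xy /negPf m0 /negPf n0 /negPf n9 _
  ->.
split=> [|j /negPf j0 /negPf jx /negPf jy].
  by rewrite /= !updE /= ?updE !(xy, n0, n9, eqxx) /= !addr0.
by rewrite /= !updE jx jy j0.
Qed.

(** * Linear time bounds for the scans and the phases of the program *)

Definition runs_le (b : nat) (c : cmd) (s s' : config R) : Prop :=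
  exists2 t, runs c s t s' & (t <= b)%N.

Lemma runs_le_weaken b b' c (s s' : config R) :
  (b <= b')%N -> runs_le b c s s' -> runs_le b' c s s'.
Proof. by move=> bb [t r tb]; exists t => //; apply: leq_trans bb. Qed.

Lemma runs_le_prim n (i : instr) (s : config R) : straight i ->
  runs_le (bound (Prim i) * n.+1) (Prim i) s (exec_instr i s).
Proof. by move=> si; exists 1%N; [exact: RunPrim|]; rewrite mul1n. Qed.

(** With one [n] fixed for the whole program, bounds of the shape constant times [n + 1] add up, so
    only the scans need a counting argument. *)
Lemma runs_le_seq n c1 c2 (s1 s2 s3 : config R) :
  runs_le (bound c1 * n.+1) c1 s1 s2 -> runs_le (bound c2 * n.+1) c2 s2 s3 ->
  runs_le (bound (Seq c1 c2) * n.+1) (Seq c1 c2) s1 s3.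
Proof.
move=> [t1 r1 h1] [t2 r2 h2]; exists (t1 + t2)%N; first exact: RunSeq r1 r2.
by rewrite mulnDl leq_add.
Qed.

Lemma runs_le_if n x y c1 c2 (s s' : config R) :
  runs_le ((if xreg s x <= xreg s y then bound c1 else bound c2) * n.+1)
    (if xreg s x <= xreg s y then c1 else c2) s s' ->
  runs_le (bound (IfR x y c1 c2) * n.+1) (IfR x y c1 c2) s s'.
Proof.
case: ifP => xy [t r h].
  by exists t.+1; [exact: RunIfThen|rewrite /=; nia].
by exists t.+2; [apply: RunIfElse; rewrite // xy|rewrite /=; nia].
Qed.

Lemma runs_le_xonly n c (s : config R) : xonly c ->
  exists2 s', runs_le (bound c * n.+1) c s s' & xstate s (xeval c (xreg s)) s'.
Proof.
move=> /(runs_xonly s)[t [s' [r e h]]]; exists s' => //.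
by exists t => //; apply: leq_trans h _; apply: leq_pmulr.
Qed.

Definition coords (l : seq (R * R)) : seq R := flatten [seq [:: p.1;
  p.2] | p <- l].

Lemma size_coords l : size (coords l) = (size l).*2.
Proof. by elim: l => //= p l ->. Qed.

Definition scanned c X (l : seq (R * R)) : nat -> R :=
  foldl (fun Y p => xeval c (upd (upd Y 0 p.1) 1 p.2)) X l.

Lemma runs_scan e c n (s : config R) (l : seq (R * R)) :
  xonly c -> (e != 3)%N -> ireg s 2 = 1%N ->
  ireg s e = (ireg s 3 + (size l).*2)%N ->
  (forall i, (i < (size l).*2)%N -> xmem s (ireg s 3 + i) = nth 0 (coords l) i)
    ->
  (size l <= n)%N ->
  exists2 s', runs_le (bound (scan_cmd e c) * n.+1) (scan_cmd e c) s s' &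
    [/\ forall j, j != 3%N -> ireg s' j = ireg s j,
        xreg s' = scanned c (xreg s) l,
        imem s' = imem s & xmem s' = xmem s].
Proof.
move=> cx e3.
(* A bound in the length of the remaining list supports the induction. A round costs [bound c], two
   loads, two pointer increments, the test and the jump back; the last test adds 1. *)
suff H : ireg s 2 = 1%N ->
  ireg s e = (ireg s 3 + (size l).*2)%N ->
  (forall i, (i < (size l).*2)%N -> xmem s (ireg s 3 + i) = nth 0 (coords l) i)
    ->
  exists2 s', runs_le ((bound c + 6) * size l + 1) (scan_cmd e c) s s' &
    [/\ forall j, j != 3%N -> ireg s' j = ireg s j,
        xreg s' = scanned c (xreg s) l,
        imem s' = imem s & xmem s' = xmem s].
  move=> h1 h2 h3 ln; have [s' r P] := H h1 h2 h3; exists s' => //.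
  by apply: runs_le_weaken r; rewrite /scan_cmd /=; nia.
elim: l s => [|p l IH] s one eE mE.
  exists s => //; exists 1%N; last by rewrite muln0.
  by apply: RunWhileEnd; rewrite eE addn0.
pose a := ireg s 3; pose I := upd (upd (ireg s) 3 (a + 1)%N) 3 (a + 1 + 1)%N.
pose X := upd (upd (xreg s) 0 p.1) 1 p.2.
have [k0 k1] : (0 < (size l).*2.+2)%N /\ (1 < (size l).*2.+2)%N by [].
pose s1 := exec_instr (IAdd 3 3 2) (exec_instr (RLoad 1 3)
  (exec_instr (IAdd 3 3 2) (exec_instr (RLoad 0 3) s))).
have s1I : ireg s1 = I.
  by rewrite /s1 /= !updE /= /I /a one.
have s1X : xreg s1 = X.
  rewrite /s1 /= /X !updE /= one; have := mE 0%N k0; have := mE 1%N k1.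
  by rewrite addn0 => -> ->.
have [t [s2 [r2 [i2 X2 m2 n2] t2]]] := runs_xonly s1 cx.
have a3 : ireg s2 3 = a.+2 by rewrite i2 s1I /I !updE /= !addn1.
have ej j : j != 3%N -> ireg s2 j = ireg s j.
  by move=> /negPf j3; rewrite i2 s1I /I !updE j3.
have [|||s3 [t3 r3 h3] [I3 X3 M3 N3]] := IH s2.
- by rewrite ej.
- by rewrite ej // eE a3 /= /a; lia.
- move=> i il; rewrite a3 n2 -/(xmem s); have := mE i.+2.
  by rewrite /= !addnS /a /s1 /= => ->.
exists s3.
  exists ((1 + (1 + (1 + (1 + t)))) + t3).+2; last by rewrite /=; lia.
  apply: RunWhileStep r3; first by rewrite eE /=; lia.
  apply: RunSeq; first exact: RunPrim.
  apply: RunSeq; first exact: RunPrim.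
  apply: RunSeq; first exact: RunPrim.
  by apply: RunSeq; first exact: RunPrim.
split.
- by move=> j j3; rewrite I3 // ej.
- by rewrite X3 X2 s1X.
- by rewrite M3 m2.
- by rewrite N3 n2.
Qed.

Lemma scanned_cons c X p l :
  scanned c X (p :: l) = scanned c (xeval c (upd (upd X 0 p.1) 1 p.2)) l.
Proof. by []. Qed.

Lemma slot_upd01 X k (x y : R) : slot (upd (upd X 0 x) 1 y) k = slot X k.
Proof. by []. Qed.

Lemma improve_scanned k d X g r (l : seq (R * R)) :
  (X 4, X 5) = g -> X 6 = r ->
  slot (scanned (improve_cmd k d) X l) k = extreme r g d (slot X k) l /\
  forall j, (4 <= j)%N -> j != slotx k -> j != sloty k ->
    scanned (improve_cmd k d) X l j = X j.
Proof.
have lo j : (j < 10)%N -> (j != slotx k) * (j != sloty k).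
  by move=> /(slot_ge k)/andP[].
elim: l X => [|p l IH] X gE rE; first by [].
rewrite scanned_cons /extreme [foldl _ _ (p :: l)]/= -/(extreme _ _ _ _ l).
have [|e f] := @improve_eval k d (upd (upd X 0 p.1) 1 p.2) g p r _ gE rE _
  erefl.
  by case: (p).
set X1 := xeval _ _ in e f *.
have [||h1 h2] := IH X1; rewrite ?f ?lo //.
rewrite h1 e slot_upd01; split=> // j j4 jx jy.
by rewrite h2 // f // !updE; case: j j4 {jx jy} => [|[]].
Qed.

Lemma cover_scanned w X (l : seq (R * R)) : X 6 = 4%:R ->
  (forall j, (4 <= j)%N -> j != 7 -> scanned (cover_cmd w) X l j = X j) /\
  scanned (cover_cmd w) X l 7 =
    (if all (fun q => has (fun k => sqdist (slot X k) q <= 4) w) l then X 7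
      else 0).
Proof.
elim: l X => [|p l IH] X X6; first by [].
rewrite scanned_cons [all _ _]/=.
have [|e f] := @cover_eval w (upd (upd X 0 p.1) 1 p.2) p _ X6 _ erefl.
  by case: (p).
set X1 := xeval _ _ in e f *.
have X1E j : (4 <= j)%N -> j != 7 -> X1 j = X j.
  by move=> j4 j7; rewrite f // !updE; case: j j4 {j7} => [|[]].
have [|h1 h2] := IH X1; first by rewrite X1E.
split=> [j j4 j7|]; first by rewrite h1 // X1E.
have sE k : slot X1 k = slot X k by rewrite /slot !X1E // /slotx /sloty; lia.
have hE q : has (fun k => sqdist (slot X1 k) q <= 4) w =
            has (fun k => sqdist (slot X k) q <= 4) w.
  by apply: eq_has => k; rewrite sE.
rewrite h2 (eq_all hE) e !updE /=.
by case: (has _ _) => //=; case: ifP.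
Qed.

(** The invariant between phases: the list ends are known and the real memory [mem] still holds the
    input. *)
Definition ready (m1 m2 : nat) (mem : nat -> R) (s : config R) : Prop :=
  [/\ ireg s 2 = 1%N, ireg s 4 = m1, ireg s 5 = m2 & xmem s = mem].

Lemma improve_xonly k d : xonly (improve_cmd k d).
Proof. by case: d => -[] []. Qed.

Lemma cover_xonly w : xonly (cover_cmd w).
Proof. by elim: w => //= k w ->. Qed.

Lemma setup_eval M k sp X z : (X 8, X 9) = z ->
  forall X', X' = xeval (setup_cmd M k sp) X ->
  [/\ slot X' k = z, (X' 4, X' 5) = grid M z sp.1.1 sp.1.2, X' 6 = sqradius,
    (forall j, j != k -> slot X' j = slot X j) & (X' 8, X' 9) = z].
Proof.
move=> <- _ ->.
rewrite (_ : xeval (setup_cmd M k sp) X = xeval (reset_cmd k) (xeval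
  (radius_cmd 100)
  (xeval (coord_cmd 100 9 5 sp.1.2 M) (xeval (coord_cmd 100 8 4 sp.1.1 M) X))))
    //.
have [c1 f1] := @coord_eval 100 8 4 sp.1.1 M X isT isT _ erefl.
set X1 := xeval _ X in c1 f1 *.
have [c2 f2] := @coord_eval 100 9 5 sp.1.2 M X1 isT isT _ erefl.
set X2 := xeval _ X1 in c2 f2 *.
have [c3 f3] := @radius_eval 100 X2 _ erefl; set X3 := xeval _ X2 in c3 f3 *.
have [c4 f4] := @reset_eval k X3 _ erefl; set X4 := xeval _ X3 in c4 f4 *.
have lo j : (j < 10)%N -> (j != slotx k) * (j != sloty k).
  by move=> /(slot_ge k)/andP[].
have X3E j : (6 < j)%N -> X3 j = X j by move=> ?; rewrite f3 ?f2 ?f1 //; lia.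
split.
- by rewrite c4 !X3E.
- by rewrite !f4 ?lo // f3 // f2 // c1 f3 // c2 f1.
- by rewrite f4 ?lo.
- move=> j /slot_neq[h1 h2 h3 h4].
  by rewrite /slot !f4 // !X3E // /slotx /sloty; lia.
- by rewrite !f4 ?lo // !X3E.
Qed.

Lemma runs_slot M k sp n z (l : seq (R * R)) m2 mem (s : config R) :
  (size l <= n)%N -> (forall i, (i < (size l).*2)%N ->
    mem i = nth 0 (coords l) i) ->
  ready (size l).*2 m2 mem s -> (xreg s 8, xreg s 9) = z ->
  exists2 s', runs_le (bound (slot_cmd M k sp) * n.+1) (slot_cmd M k sp) s s' &
    [/\ ready (size l).*2 m2 mem s',
        slot (xreg s') k = slot_point M z l sp,
        forall j, j != k -> slot (xreg s') j = slot (xreg s) j &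
        (xreg s' 8, xreg s' 9) = z].
Proof.
move=> ln memE [s2 s4 s5 sm] zE.
pose s1 := exec_instr (IConst 3 0) s.
have r1 : runs_le (bound (Prim (IConst 3 0)) * n.+1) (Prim (IConst 3 0)) s s1.
  exact: runs_le_prim.
have [t r2 [t1 t2 t3 t4]] := @runs_le_xonly n (setup_cmd M k sp) s1 isT.
have [E1 E2 E3 E4 E5] := setup_eval zE t2.
have [||||s' r3 [i3 x3 _ n3]] := @runs_scan 4 (improve_cmd k sp.2) n t l
  (improve_xonly _ _) isT.
- by rewrite t1 /s1 /= updE.
- by rewrite t1 /s1 /= !updE.
- by move=> i il; rewrite t4 t1 /s1 /= updE /= add0n sm memE.
- exact: ln.
have [e f] := improve_scanned k sp.2 l E2 E3.
exists s'; first by apply: runs_le_seq r1 _; apply: runs_le_seq r2 r3.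
have lo j : (j < 10)%N -> (j != slotx k) * (j != sloty k).
  by move=> /(slot_ge k)/andP[].
split.
- by split; rewrite ?i3 ?n3 // ?t1 ?t4 /s1 /= ?updE.
- by rewrite x3 e E1.
- move=> j jk; rewrite -E4 // x3; have [h1 h2 h3 h4] := slot_neq jk.
  by rewrite /slot !f.
- by rewrite x3 !f ?lo.
Qed.

Lemma runs_slots M k sps n z (l : seq (R * R)) m2 mem (s : config R) :
  (size l <= n)%N -> (forall i, (i < (size l).*2)%N ->
    mem i = nth 0 (coords l) i) ->
  ready (size l).*2 m2 mem s -> (xreg s 8, xreg s 9) = z ->
  exists2 s', runs_le (bound (slots_cmd M k sps) * n.+1) (slots_cmd M k sps) s
    s' &
    [/\ ready (size l).*2 m2 mem s',
        forall j sp0, (j < size sps)%N ->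
          slot (xreg s') (k + j) = slot_point M z l (nth sp0 sps j) &
        forall j, (j < k)%N -> slot (xreg s') j = slot (xreg s) j].
Proof.
move=> ln memE; elim: sps k s => [|sp sps IH] k s rs zE.
  by exists s; [exists 0%N => //; exact: RunSkip|split].
have [s1 r1 [rs1 e1 f1 z1]] := runs_slot M k sp ln memE rs zE.
have [s2 r2 [rs2 e2 f2]] := IH k.+1 s1 rs1 z1.
exists s2; first exact: runs_le_seq r1 r2.
split=> // [[|j] sp0 js|j jk].
- by rewrite addn0 f2 // e1.
- by rewrite addnS -addSn (e2 _ sp0).
- by rewrite f2 ?f1 //; lia.
Qed.

Lemma runs_check w n (l l' : seq (R * R)) mem (s : config R) :
  (size l' <= n)%N ->
  (forall i, (i < (size l').*2)%N -> mem ((size l).*2 + i)%N = nth 0 (coords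
    l') i) ->
  ready (size l).*2 ((size l).*2 + (size l').*2) mem s ->
  exists2 s', runs_le (bound (check_cmd w) * n.+1) (check_cmd w) s s' &
    [/\ ready (size l).*2 ((size l).*2 + (size l').*2) mem s',
        forall j, slot (xreg s') j = slot (xreg s) j &
        (xreg s' 8 <= xreg s' 7) =
          all (fun q => has (fun k => sqdist (slot (xreg s) k) q <= 4) w) l'].
Proof.
move=> ln memE [s2 s4 s5 sm].
pose s0 := exec_instr (IConst 3 0) s; pose s1 := exec_instr (IAdd 3 3 4) s0.
have r0 : runs_le (bound (Prim (IConst 3 0)) * n.+1) (Prim (IConst 3 0)) s s0.
  exact: runs_le_prim.
have r1 : runs_le (bound (Prim (IAdd 3 3 4)) * n.+1) (Prim (IAdd 3 3 4)) s0 s1.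
  exact: runs_le_prim.
rewrite /check_cmd; set b := block _.
have [t r2 [t1 t2 t3 t4]] := @runs_le_xonly n b s1 isT.
have tE j : slot (xreg t) j = slot (xreg s) j by rewrite t2.
have [E6 E7 E8] : [/\ xreg t 6 = 4%:R, xreg t 7 = 1 &
  xreg t 8 = 1] by rewrite t2.
have i1 j : j != 3%N -> ireg t j = ireg s j.
  by move=> /negPf j3; rewrite t1 /s1 /s0 /= !updE j3.
have i13 : ireg t 3 = (size l).*2 by rewrite t1 /s1 /s0 /= !updE /= add0n.
have [||||s' r3 [i3 x3 _ n3]] := @runs_scan 5 (cover_cmd w) n t l' (cover_xonly
  _) isT.
- by rewrite i1.
- by rewrite i1 // s5 i13.
- by move=> i il; rewrite t4 i13 /= sm memE.
- exact: ln.
have [f e] := cover_scanned w l' E6.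
exists s'.
  by apply: runs_le_seq r0 _; apply: runs_le_seq r1 _; apply: runs_le_seq r2 r3.
split.
- by split; rewrite ?i3 ?i1 // n3 t4.
- move=> j; rewrite -tE x3 /slot !f // /slotx /sloty; lia.
- rewrite x3 f // e E7 E8.
  under eq_all => q do under eq_has => k do rewrite tE.
  by case: (all _ _); rewrite ?lexx // ler10.
Qed.

(** The clause on cells before [i] carries the induction: later writes must not destroy the points
    already written. *)
Lemma runs_emit i w n (s : config R) :
  exists2 s', runs_le (bound (emit_cmd i w) * n.+1) (emit_cmd i w) s s' &
    [/\ ireg s' 0 = (i + size w)%N,
        forall j, (j < i)%N -> (xmem s' j.*2, xmem s' j.*2.+1) = (xmem s j.*2,
          xmem s j.*2.+1) &
        forall j, (j < size w)%N ->
          (xmem s' (i + j).*2, xmem s' (i + j).*2.+1) = slot (xreg s) (nth 0%N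
            w j)].
Proof.
elim: w i s => [|k w IH] i s.
  exists (exec_instr (IConst 0 i) s); first exact: runs_le_prim.
  by split=> //=; rewrite updE addn0.
pose s1 := exec_instr (IConst 3 i.*2) s.
pose s2 := exec_instr (RStore 3 (slotx k)) s1.
pose s3 := exec_instr (IConst 3 i.*2.+1) s2.
pose s4 := exec_instr (RStore 3 (sloty k)) s3.
have [s5 r5 [I5 A5 B5]] := IH i.+1 s4.
have m4 j : xmem s4 j = if j == i.*2.+1 then xreg s (sloty k) else
                        if j == i.*2 then xreg s (slotx k) else xmem s j.
  by rewrite /s4 /s3 /s2 /s1 /= !updE.
exists s5.
  rewrite [emit_cmd _ _]/=.
  apply: (@runs_le_seq n _ _ s s1); first exact: runs_le_prim.
  apply: (@runs_le_seq n _ _ s1 s2); first exact: runs_le_prim.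
  apply: (@runs_le_seq n _ _ s2 s3); first exact: runs_le_prim.
  by apply: (@runs_le_seq n _ _ s3 s4); first exact: runs_le_prim.
have ii : (i.*2 == i.*2.+1) = false by lia.
split.
- by rewrite I5 /=; lia.
- move=> j ji; rewrite A5 ?m4; last by lia.
  by do ![rewrite (_ : (_ == _) = false); last by lia].
- case=> [|j] js /=; last by rewrite addnS -addSn B5.
  by rewrite addn0 A5 // !m4 eqxx ii eqxx.
Qed.

Lemma runs_search cs n (l l' : seq (R * R)) mem (s : config R) (v : nat ->
  R * R) :
  (size l' <= n)%N ->
  (forall i, (i < (size l').*2)%N -> mem ((size l).*2 + i)%N = nth 0 (coords
    l') i) ->
  ready (size l).*2 ((size l).*2 + (size l').*2) mem s ->
  (forall k, slot (xreg s) k = v k) ->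
  let ok w := all (fun q => has (fun k => sqdist (v k) q <= 4) w) l' in
  has ok cs ->
  exists2 s', runs_le (bound (search_cmd cs) * n.+1) (search_cmd cs) s s' &
    output s' = [seq v k | k <- nth [::] cs (find ok cs)].
Proof.
move=> ln memE + + ok; elim: cs s => [|w cs IH] //= s rs sv okcs.
have [s1 r1 [rs1 e1 b1]] := runs_check w ln memE rs.
have b1' : (xreg s1 8 <= xreg s1 7) = ok w.
  by rewrite b1; apply: eq_all => q; apply: eq_has => k; rewrite sv.
have [s2 r2 o2] : exists2 s', runs_le
    (bound (IfR 8 7 (emit_cmd 0 w) (search_cmd cs)) * n.+1)
    (IfR 8 7 (emit_cmd 0 w) (search_cmd cs)) s1 s' &
    output s' = [seq v k | k <- nth [::] (w :: cs) (if ok w then 0%N else (find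
      ok cs).+1)].
  case okw: (ok w) okcs => /= okcs; last first.
    have [|s2 r2 o2] := IH s1 rs1 _ okcs; first by move=> k; rewrite e1.
    by exists s2 => //; apply: runs_le_if; rewrite b1' okw.
  have [s2 r2 [I2 _ m2]] := runs_emit 0 w n s1.
  exists s2; first by apply: runs_le_if; rewrite b1' okw.
  rewrite /output I2 add0n; apply: (@eq_from_nth _ 0);
    rewrite !size_map size_iota //.
  move=> i iw; rewrite (nth_map 0%N) ?size_iota // nth_iota // (nth_map 0%N) //.
  by have := m2 i iw; rewrite !add0n e1 sv.
by exists s2 => //; apply: runs_le_seq r1 r2.
Qed.

End Program.

(** * Correctness *)

Fixpoint words (T : Type) (l : seq T) (i : nat) : seq (seq T) :=
  if i is i'.+1 then [seq x :: w | x <- l, w <- words l i'] else [:: [::]].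

Lemma mem_words (T : eqType) (l : seq T) i w :
  (w \in words l i) = (size w == i) && all [in l] w.
Proof.
elim: i w => [|i IH] [|x w] //=.
  by apply/allpairsP => -[[y w'] [_ _]].
rewrite eqSS; apply/allpairsP/idP => [[[y w'] /= [yl]]|].
  by rewrite IH => /andP[s a] [-> ->]; rewrite s yl.
by case/and3P=> s xl a; exists (x, w); rewrite /= IH s.
Qed.

(** Words, possibly with repetitions, stand in for subsets; sorting by size makes the first success
    a smallest one. *)
Definition candidates (T : Type) (l : seq T) : seq (seq T) :=
  sort (fun w w' : seq T => size w <= size w')%N
    (flatten [seq words l i | i <- iota 0 (size l).+1]).

Lemma mem_candidates (T : eqType) (l : seq T) w :
  (w \in candidates l) = (size w <= size l)%N && all [in l] w.
Proof.
rewrite mem_sort; apply/flatten_mapP/idP => [[i]|/andP[sw aw]].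
  by rewrite mem_iota mem_words add0n ltnS => /= il /andP[/eqP -> ->];
    rewrite il.
by exists (size w); rewrite ?mem_iota // mem_words eqxx.
Qed.

Lemma find_candidates (T : eqType) (l : seq T) (ok : pred (seq T)) w :
  w \in candidates l -> ok w ->
  let w0 := nth [::] (candidates l) (find ok (candidates l)) in
  [/\ ok w0, w0 \in candidates l & (size w0 <= size w)%N].
Proof.
move=> wc okw w0; have hok : has ok (candidates l) by apply/hasP; exists w.
split; [exact: nth_find|by rewrite mem_nth // -has_find|].
have fi : (find ok (candidates l) <= index w (candidates l))%N.
  rewrite leqNgt; apply/negP => /(before_find [::]).
  by rewrite nth_index // okw.
have iw : (index w (candidates l) < size (candidates l))%N by rewrite index_mem.
have := @sorted_leq_nth _ (fun w w' : seq T => size w <= size w')%N _ _ [::]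
  (candidates l) _ _ _ _ _ fi.
rewrite nth_index //; apply.
- by move=> a b c; apply: leq_trans.
- by move=> a; exact: leqnn.
- by apply: sort_sorted => a b; apply: leq_total.
- by rewrite inE; apply: leq_ltn_trans fi iw.
- by rewrite inE.
Qed.

(** Different slots may hold the same point. A word that selects each point once is again a
    candidate, so a smallest successful word outputs no point twice. *)
Lemma undup_map_preimage (T T' : eqType) (f : T -> T') (w : seq T) :
  exists2 w', {subset w' <= w} & map f w' = undup (map f w).
Proof.
elim: w => [|x w [w' sw e]]; first by exists [::].
rewrite /=; case: ifP => _.
  by exists w' => // y /sw; rewrite inE orbC => ->.
exists (x :: w'); last by rewrite /= e.
by move=> y; rewrite !inE => /predU1P[->|/sw ->]; rewrite ?eqxx ?orbT.
Qed.

Section Main.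
Context {R : realType}.
Implicit Types (p q z : R * R) (P : {fset R * R}).

Lemma dominatesE p q : dominates p q <-> sqdist p q <= 4.
Proof.
by rewrite /dominates dist_le // (_ : 2 ^+ 2 = 4 :> R) //; ring.
Qed.

Lemma le_diam P p q : p \in P -> q \in P -> dist p q <= diam P.
Proof.
move=> pP qP; rewrite /diam.
have h1 : dist p q <= \big[Num.max/0]_(q' <- P) dist p q'.
  exact: (@le_bigmax_seq _ R _ P 0 q xpredT (fun q' => dist p q') qP isT).
apply: le_trans h1 _.
exact: (@le_bigmax_seq _ R _ P 0 p xpredT
  (fun p' => \big[Num.max/0]_(q' <- P) dist p' q') pP isT).
Qed.

Lemma dist_coord (M : R) p q : 0 <= M -> dist p q <= M ->
  `|p.1 - q.1| <= M /\ `|p.2 - q.2| <= M.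
Proof.
move=> M0; rewrite dist_le // /sqdist -!expr2 => h.
have c (x : R) : x ^+ 2 <= M ^+ 2 -> `|x| <= M.
  by rewrite -(real_normK (num_real x)) ler_pXn2r // ?nnegrE.
by split; apply: c; apply: le_trans h; rewrite ?lerDl ?lerDr sqr_ge0.
Qed.

Lemma card_enumerates (s : seq (R * R)) P : enumerates s P -> #|` P| = size s.
Proof.
by move=> [us sP]; apply/esym/perm_size/uniq_perm; rewrite ?fset_uniq.
Qed.

Lemma coords_cat (s s' : seq (R * R)) : coords (s ++ s') = coords s ++ coords
  s'.
Proof. by rewrite /coords map_cat flatten_cat. Qed.

Lemma runs_block n l (s : config R) : all straight l ->
  runs_le (bound (block l) * n.+1) (block l) s (foldl (fun s i => exec_instr i
    s) s l).
Proof.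
elim: l s => [|i l IH] s /=; first by exists 0%N => //; exact: RunSkip.
move=> /andP[si /IH h]; apply: (@runs_le_seq _ n (Prim i)); last exact: h.
exact: runs_le_prim.
Qed.

(** The program addresses slots by their index in [specs M], while the correctness argument speaks
    of cells and directions; the search is transferred from one to the other. *)
Lemma runs_main M (ws : seq (seq spec)) n (s s' : seq (R * R)) :
  (size s <= n)%N -> (size s' <= n)%N ->
  (forall w, w \in ws -> {subset w <= specs M}) ->
  let c := main_cmd M [seq [seq index sp (specs M) | sp <- w] | w <- ws] in
  let z := (nth 0 (coords (s ++ s')) 0, nth 0 (coords (s ++ s')) 1) in
  let ok w := all (fun q => has (fun sp => sqdist (slot_point M z s sp) q <= 4)
    w) s' in
  has ok ws ->
  exists2 t, runs_le (bound c * n.+1) c (init_config s s') t &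
    output t = [seq slot_point M z s sp | sp <- nth [::] ws (find ok ws)].
Proof.
move=> ln ln' wsM c z ok okws.
pose mem := nth 0 (coords (s ++ s')).
have [t1 r1 [rt1 z1]] : exists2 t, runs_le (bound init_cmd * n.+1) init_cmd
  (init_config s s') t &
    ready (size s).*2 ((size s).*2 + (size s').*2) mem t /\ (xreg t 8,
      xreg t 9) = z.
  eexists; first exact: runs_block.
  by split; first split; rewrite //= !updE /= ?updE /= ?addnn // addnC.
have m1 i : (i < (size s).*2)%N -> mem i = nth 0 (coords s) i.
  by move=> il; rewrite /mem coords_cat nth_cat size_coords il.
have m2 i : (i < (size s').*2)%N -> mem ((size s).*2 + i)%N = nth 0 (coords s')
  i.
  by move=> il; rewrite /mem coords_cat nth_cat size_coords ltnNge leq_addr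
    addKn.
have [t2 r2 [rt2 e2 _]] := runs_slots M 0 (specs M) ln m1 rt1 z1.
have vE sp : sp \in specs M -> slot (xreg t2) (index sp (specs M)) = slot_point
  M z s sp.
  by move=> spM; rewrite -[index _ _]add0n (e2 _ sp) ?index_mem // nth_index.
pose ok' w := all (fun q => has (fun k => sqdist (slot (xreg t2) k) q <= 4) w)
  s'.
have okE : {in ws, forall w, ok' [seq index sp (specs M) | sp <- w] = ok w}.
  move=> w /wsM wM; apply: eq_all => q; rewrite has_map;
    apply: eq_in_has => sp /wM spM /=.
  by rewrite vE.
have okf : {in ws, (fun w => ok' [seq index sp (specs M) | sp <- w]) =1 ok} by
  exact: okE.
have [|t3 r3 o3] := runs_search (cs := [seq [seq index sp (specs M) | sp <- w]
  | w <- ws])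
    ln' m2 rt2 (fun k => erefl).
  by rewrite has_map (eq_in_has okf).
exists t3; first by apply: runs_le_seq r1 _; apply: runs_le_seq r2 r3.
have fE : find ok' [seq [seq index sp (specs M) | sp <- w] | w <- ws] = find ok
  ws.
  by rewrite find_map (eq_in_find okf).
rewrite o3 [find _ _]fE (nth_map [::]) -?has_find // -map_comp.
apply/eq_in_map => sp spw; rewrite /= vE //.
by apply: wsM spw; rewrite mem_nth // -has_find.
Qed.

End Main.

Theorem theorem3 (R : realType) (B : R) :
  exists (prog : program) (C : nat),
  forall (n : nat) (P P' : {fset R * R}) (s s' : seq (R * R)),
    #|` P| = n -> diam P <= B -> P' `<=` P ->
    enumerates s P -> enumerates s' P' ->
  exists (t : nat) (c : config R) (D : {fset R * R}),
    [/\ halts_in prog (init_config s s') t c,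
        (t <= C * n.+1)%N,
        enumerates (output c) D,
        feasible_PDS P P' D &
        forall OPT : {fset R * R}, optimal_PDS P P' OPT ->
          (#|` D| <= 4 * #|` OPT|)%N].
Proof.
(* The real number [B] cannot occur in a program, so a natural number above it fixes the size of the
   grid. *)
pose M := Num.bound `|B|.
have M0 : 0 <= M%:R :> R by exact: ler0n.
have BM : B <= M%:R.
  by apply: le_trans (ler_norm B) _; apply/ltW/archi_boundP.
pose ws := candidates (specs M).
pose c := main_cmd M [seq [seq index sp (specs M) | sp <- w] | w <- ws].
exists (compile 0 c), (bound c) => n P P' s s' Pn dP PP' es es'.
have [us sP] := es; have [us' sP'] := es'.
have ss' : {subset s' <= s} by move=> q; rewrite sP' sP; exact: (fsubsetP PP').
have sn : size s = n by rewrite -(card_enumerates es).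
have sn' : (size s' <= n)%N by rewrite -sn; apply: uniq_leq_size.
pose z := (nth 0 (coords (s ++ s')) 0, nth 0 (coords (s ++ s')) 1).
(* [z] is the first input point, or a default value if [s] is empty. *)
have zs p : p \in s -> z \in s.
  by rewrite /z; case: (s) => // -[x y] l _; rewrite /= mem_head.
have box p : p \in s -> `|p.1 - z.1| <= M%:R /\ `|p.2 - z.2| <= M%:R.
  move=> ps; apply: dist_coord => //; apply: le_trans BM; apply: le_trans dP.
  by apply: le_diam; rewrite -sP //; apply: zs ps.
pose v := slot_point M z s.
pose ok w := all (fun q => has (fun sp => sqdist (v sp) q <= 4) w) s'.
have wsM w : w \in ws -> {subset w <= specs M}.
  by rewrite mem_candidates => /andP[_ /allP].
(* Applied to an optimum this gives the factor 4, and applied to [P] it shows that the search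
   succeeds. Removing duplicates keeps the word within the length limit of [candidates]. *)
have cover D : feasible_PDS P P' D -> exists w, [/\ w \in ws, ok w &
  (size w <= 4 * #|` D|)%N].
  move=> [DP Ddom].
  have [|q|S [SM Ss SP]] := @cover_all _ M z s s' box ss' (enum_fset D).
  - by move=> p pD; rewrite sP; apply: (fsubsetP DP).
  - by rewrite sP' => /Ddom[p pD /dominatesE pq]; exists p.
  have uS : (size (undup S) <= size (specs M))%N.
    by apply: uniq_leq_size; rewrite ?undup_uniq // => x;
      rewrite mem_undup => /SM.
  exists (undup S); split.
  - by rewrite mem_candidates uS; apply/allP => x; rewrite mem_undup => /SM.
  - by apply/allP => q /SP; rewrite (eq_has_r (mem_undup S)).
  - exact: leq_trans (size_undup S) Ss.
have feas : feasible_PDS P P' P.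
  split=> // q qP'; exists q; first exact: (fsubsetP PP').
  by apply/dominatesE; rewrite /sqdist !subrr !mulr0 addr0.
have okws : has ok ws by have [w [wws okw _]] := cover P feas; apply/hasP;
  exists w.
have [t [T rT bT] oT] := runs_main (eq_leq sn) sn' wsM okws.
pose w0 := nth [::] ws (find ok ws); change (output t = map v w0) in oT.
have min w : w \in ws -> ok w -> [/\ ok w0, w0 \in ws & (size w0 <= size w)%N].
  exact: find_candidates.
have [ok0 w0ws] : ok w0 /\ w0 \in ws.
  by have [w [wws okw _]] := cover P feas; have [] := min w wws okw.
(* If two slots of [w0] held the same point, [w'] would be a shorter successful candidate. *)
have uo : uniq (map v w0).
  rewrite -[X in uniq X]undup_id ?undup_uniq //.
  have [w' w'w e] := undup_map_preimage v w0.
  have sw' : (size w' <= size w0)%N by rewrite -(size_map v w') e -(size_map v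
    w0) size_undup.
  have w'ws : w' \in ws.
    move: w0ws; rewrite !mem_candidates => /andP[s0 /allP a0].
    rewrite (leq_trans sw' s0); apply/allP => x /w'w; exact: a0.
  have okw' : ok w'.
    apply/allP => q /(allP ok0); rewrite -!(has_map v (fun p => sqdist p q <=
      4)) e.
    by rewrite (eq_has_r (mem_undup _)).
  have [_ _] := min w' w'ws okw'; rewrite -(size_map v w') e -(size_map v w0).
  by rewrite leqNgt ltn_size_undup negbK.
have vs sp q : q \in s -> v sp \in s.
  move=> qs; have := extreme_mem sqradius (grid M z sp.1.1 sp.1.2) sp.2 z s.
  by rewrite inE => /predU1P[e|//]; rewrite /v /slot_point e (zs q).
pose D : {fset R * R} := [fset p in map v w0].
have oD : enumerates (output (goto t (len c))) D.
  change (output (goto t (len c))) with (output t); rewrite oT.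
  by split=> // p; rewrite inE.
exists T, (goto t (len c)), D; split=> //.
- exact: runs_halts rT erefl.
- split; last first.
    move=> q; rewrite -sP' => /(allP ok0)/hasP[sp spw h].
    by exists (v sp); [rewrite inE map_f|apply/dominatesE].
  apply/fsubsetP => p; rewrite inE -sP => /mapP[sp spw ->].
  (* On empty input the slots hold a default point outside [P], but the empty word succeeds, so [w0]
     is empty by minimality. *)
  have [s0|[q qs]] : s = [::] \/ exists q, q \in s.
    by case: (s) => [|q l]; [left|right; exists q; rewrite mem_head].
    suff w00 : w0 = [::] by rewrite w00 in spw.
    have s'0 : s' = [::] by case: (s') ss' => // q l /(_ q (mem_head _ _));
      rewrite s0.
    have [||_ _] := min [::]; [by rewrite mem_candidates|by rewrite /ok s'0|].
    by case: (w0).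
  exact: vs qs.
- move=> OPT [fO _]; have [w [wws okw sw]] := cover OPT fO.
  have [_ _ m] := min w wws okw; rewrite (card_enumerates oD).
  change (output (goto t (len c))) with (output t).
  by rewrite oT size_map; apply: leq_trans m sw.
Qed.
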